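(* Let $m,s\ge2$ be integers and let $\mathcal F$ be an $m$-block Ferrers diagram of order $sm$. If $(\mathcal F,d)$ is MSRD-constructible, with $d\in\{1,\dots,m+1\}\cup\{sm-1,sm\}$, then there exists an $[\mathcal F,\nu_{\min}(\mathcal F,d),d]_q$ MFD code over any finite field $\mathbb F_q$.
   Context: Notation: $[n]=\{1,\dots,n\}$, $[0]=\emptyset$. A (top-right justified) Ferrers diagram of order $n$ is a subset $\mathcal F\subseteq[n]^2$ such that (1) $(i,j)\in\mathcal F$ and $j<n$ imply $(i,j+1)\in\mathcal F$; (2) $(i,j)\in\mathcal F$ and $i>1$ imply $(i-1,j)\in\mathcal F$. Write $\mathcal F=[c_1,\dots,c_n]$ where $c_j$ is the number of elements of $\mathcal F$ in column $j$. For $d\in[n]$ and $j\in\{0,\dots,d-1\}$ let $\nu_j(\mathcal F,d)=\sum_{i=1}^{n-j}\max\{0,c_i-d+1+j\}$ and $\nu_{\min}(\mathcal F,d)=\min_{0\le j\le d-1}\nu_j(\mathcal F,d)$. Codes: $\mathbb F_q^{\mathcal F}$ is the space of $n\times n$ matrices over $\mathbb F_q$ whose entries outside the positions in $\mathcal F$ are zero. An $[\mathcal F,k,d]_q$ code is a $k$-dimensional $\mathbb F_q$-linear subspace of $\mathbb F_q^{\mathcal F}$ whose minimum rank over nonzero elements is $d$ (the zero code is regarded as an $[\mathcal F,0,d]_q$ code). It is an MFD (maximum Ferrers diagram) code if $k=\nu_{\min}(\mathcal F,d)$. Blocks: $Q_{i,j}:=([im]\setminus[(i-1)m])\times([jm]\setminus[(j-1)m])$.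 A Ferrers diagram $\mathcal F$ of order $sm$ is an $m$-block Ferrers diagram if $Q_{i,j}\cap\mathcal F\in\{\emptyset,Q_{i,j}\}$ for all $i,j\in[s]$; its block set is $\mathbf B(\mathcal F)=\{Q_{i,j}: i,j\in[s],\ Q_{i,j}\subseteq\mathcal F\}$. Block diagonals: $D_i^B=\{Q_{l,s-i+l}:1\le l\le i\}$, $i\in[s]$. The pair $(\mathcal F,d)$ is MSRD-constructible if $\nu_{\min}(\mathcal F,d)=m\sum_{i=1}^s\max\{m|D_i^B\cap\mathbf B(\mathcal F)|-d+1,0\}$. *)

(* Defs.v *)
From HB Require Import structures.
From mathcomp Require Import all_boot all_order all_algebra.

Set Implicit Arguments.
Unset Strict Implicit.
Unset Printing Implicit Defensive.

Import GRing.Theory.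

(* All row, column and block indices are 0-based: the element i of 'I_n
   stands for the integer i + 1 of [n] = {1, ..., n}. *)

Definition is_Ferrers (n : nat) (D : {set 'I_n * 'I_n}) : Prop :=
  (forall i j j' : 'I_n, (i, j) \in D -> j' = j.+1 :> nat -> (i, j') \in D) /\
  (forall i i' j : 'I_n, (i, j) \in D -> i = i'.+1 :> nat -> (i', j) \in D).

Definition col_card (n : nat) (D : {set 'I_n * 'I_n}) (j : 'I_n) : nat :=
  #|[set i : 'I_n | (i, j) \in D]|.

(* Truncated subtraction gives max(0, c_i - d + 1 + j). *)
Definition nu (n : nat) (D : {set 'I_n * 'I_n}) (d j : nat) : nat :=
  \sum_(i < n | i < n - j) (col_card D i + 1 + j - d).

(* For d >= 1 the default value nu D d 0 is one of the terms of the minimum. *)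
Definition nu_min (n : nat) (D : {set 'I_n * 'I_n}) (d : nat) : nat :=
  \big[minn/nu D d 0]_(j < d) nu D d j.

Definition supported_on (K : finFieldType) (n : nat) (D : {set 'I_n * 'I_n})
    (A : 'M[K]_n) : Prop :=
  forall i j : 'I_n, (i, j) \notin D -> A i j = 0%R.

Definition has_min_rank (K : finFieldType) (n : nat) (C : {vspace 'M[K]_n})
    (d : nat) : Prop :=
  (exists A : 'M[K]_n, [/\ A \in C, A != 0%R & \rank A = d]) /\
  (forall A : 'M[K]_n, A \in C -> A != 0%R -> d <= \rank A).

(* C is a [D, k, d]_q code, q = #|K|; the zero code is a [D, 0, d]_q code for
   every d. *)
Definition is_code (K : finFieldType) (n : nat) (D : {set 'I_n * 'I_n})
    (k d : nat) (C : {vspace 'M[K]_n}) : Prop :=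
  [/\ forall A : 'M[K]_n, A \in C -> supported_on D A,
      \dim C = k
    & C = 0%VS \/ has_min_rank C d].

Definition is_MFD_code (K : finFieldType) (n : nat) (D : {set 'I_n * 'I_n})
    (k d : nat) (C : {vspace 'M[K]_n}) : Prop :=
  is_code D k d C /\ k = nu_min D d.

Definition block (s m : nat) (i j : 'I_s) : {set 'I_(s * m) * 'I_(s * m)} :=
  [set p : 'I_(s * m) * 'I_(s * m) |
    (i * m <= p.1 < i.+1 * m) && (j * m <= p.2 < j.+1 * m)].

Definition is_block_Ferrers (s m : nat) (D : {set 'I_(s * m) * 'I_(s * m)}) :
    Prop :=
  is_Ferrers D /\
  (forall i j : 'I_s,
     block m i j :&: D = set0 \/ block m i j :&: D = block m i j).

Definition block_set (s m : nat) (D : {set 'I_(s * m) * 'I_(s * m)}) :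
    {set {set 'I_(s * m) * 'I_(s * m)}} :=
  [set block m p.1 p.2 | p : 'I_s * 'I_s & block m p.1 p.2 \subset D].

(* The block diagonal D_i^B for 1 <= i <= s: here i is the 1-based index, while
   the row l and the column s - i + l of a block are both shifted down by 1. *)
Definition block_diag (s m i : nat) : {set {set 'I_(s * m) * 'I_(s * m)}} :=
  [set block m p.1 p.2 | p : 'I_s * 'I_s
     & (p.1 < i) && (p.2 == s - i + p.1 :> nat)].

Definition MSRD_constructible (s m : nat) (D : {set 'I_(s * m) * 'I_(s * m)})
    (d : nat) : Prop :=
  nu_min D d =
    m * \sum_(1 <= i < s.+1) (m * #|block_diag s m i :&: block_set D| + 1 - d).

(* Main.v *)
From HB Require Import structures.
Require Import Defs.
From mathcomp Require Import all_boot all_order all_algebra all_field.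
From mathcomp Require Import zify ring.

Set Implicit Arguments.
Unset Strict Implicit.
Unset Printing Implicit Defensive.

Import GRing.Theory passmx.

(** Let q = #|K| and n = s m, and call a code large if its nonzero matrices
    have rank at least d and its dimension is at least nu_min D d.  A large
    code supported on D contains an MFD code ([MFD_of_large_code]): truncate
    it to dimension nu_min D d.  Rank exactly d is then attained, because for
    the index j that realises the minimum there are fewer than nu_min D d
    positions of D outside the first d - j rows and the last j columns, so
    some nonzero codeword lives on these d lines.  Hence it is enough to build
    large codes over an arbitrary finite field.

    For d at most m + 1, a block diagonal with b > 0 blocks in D contributes
    m (m b - d + 1) to the MSRD formula, because m b >= m >= d - 1.  If t
    block diagonals are nonempty, they are the t shortest ones, and the
    formula equals #|U| - (d - 1) t m, where U is the part of D made of the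
    blocks on or above the main block diagonal.  Moreover U lies in the top
    right square of side N = t m.  The N x N Gabidulin code of distance d has
    dimension N^2 - (d - 1) N, and requiring its matrices to vanish outside U
    costs at most N^2 - #|U| linear conditions: what remains
    ([supported_Gabidulin_code]) has dimension at least the formula, which is
    nu_min D d, and Gabidulin codes exist over every finite field.

    For d = n - 1 or d = n, only the main block diagonal can contribute to the
    formula, and only if all its blocks belong to D.  Otherwise nu_min D d = 0
    and the zero code is large.  In the remaining case D contains the
    upper block triangle and nu_min D d = k m with k = n - d + 1, which is 1
    or 2.  Let E be the extension of K of degree m.  For d = n take the
    block diagonal matrices that repeat the multiplication by an element a of
    E along the diagonal.  For d = n - 1, put the same operator
    f x = a x + b x^q in all diagonal blocks; since f may be singular, this
    alone could lose one dimension per block.  So put g x = c b x^q in the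
    blocks just above the diagonal, where c is not of the form z - z^q.  The
    choice of c makes g x lie outside the image of f for every nonzero x in
    the kernel of f, so all but one of these losses are prevented
    ([staircase_code]). *)

(** * The Frobenius endomorphism of a finite extension *)

Local Open Scope ring_scope.

(** The splitting field of X^Q - X with Q = q^N: its Q distinct roots are the
    fixed points of the N-th power of the Frobenius map, so they form a
    subfield, which is then everything.  The Frobenius map is returned as a
    K-linear endomorphism, which spares later proofs the additivity of x^q. *)
Lemma ex_extension_Frobenius (K : finFieldType) (N : nat) : (0 < N)%N ->
  exists (E : fieldExtType K) (phi : 'End(E)),
    \dim {:E} = N /\ forall x, phi x = x ^+ #|K|.
Proof.
move=> N_gt0; set q := #|K|; set Q := (q ^ N)%N.
have q_gt1 : (1 < q)%N by apply: finNzRing_gt1.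
have Q_gt1 : (1 < Q)%N by rewrite (ltn_exp2l 0).
have Q_gt0 := ltnW Q_gt1; have Q1_gt0 : (0 < Q.-1)%N by rewrite -ltnS prednK.
pose P (R : nzRingType) : {poly R} := 'X^Q - 'X.
have DP R : P R = ('X^(Q.-1) - 1) * ('X - 0).
  by rewrite subr0 mulrBl mul1r -exprSr prednK.
have /FinSplittingFieldFor[/= L splitLP] : P K != 0.
  by rewrite DP monic_neq0 ?rpredM ?monicXsubC ?monicXnsubC.
rewrite [map_poly _ _]rmorphB rmorphXn /= map_polyX -/(P L) in splitLP.
have [p _ pcharK] := finPcharP K.
have [e Dq] : {e | q = p ^ e}%N.
  by have := card_pprimeChar pcharK; rewrite -/q => /= ->; eexists.
have e_gt0 : (0 < e)%N by case: (e) Dq q_gt1 => // ->.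
have pcharL : p \in [pchar L] by rewrite pchar_lalg.
have /finField_galois_generator[/= a _ Da] : (1 <= {:L})%VS by apply: sub1v.
rewrite dimv1 expn1 in Da.
pose Em := fixedSpace (a ^+ N)%g.
have [zs DzP defL] := splitLP.
have Uzs : uniq zs.
  rewrite -separable_prod_XsubC -(eqp_separable DzP) DP separable_root andbC.
  rewrite /root !hornerE subr_eq0 eq_sym expr0n gtn_eqF ?oner_eq0 //=.
  rewrite cyclotomic.separable_Xn_sub_1 // -subn1 natrB // subr_eq0.
  by rewrite /Q Dq !natrX pcharf0 // -exprM
    expr0n gtn_eqF ?muln_gt0 ?e_gt0 // eq_sym oner_eq0.
have in_zs : zs =i Em.
  move=> z; rewrite -root_prod_XsubC -(eqp_root DzP) (sameP fixedSpaceP eqP).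
  rewrite /root !hornerE subr_eq0 /= /Q; congr (_ == z).
  elim: (N) => [|i IHi]; first by rewrite gal_id.
  by rewrite expgSr expnSr exprM IHi galM ?Da ?memvf.
have defEm : Em = {:L}%VS.
  apply/eqP; rewrite eqEsubv subvf -defL -[Em]subfield_closed agenvS //.
  by rewrite subv_add sub1v; apply/span_subvP=> z; rewrite in_zs.
have cardL : #|finvect_type L| = Q.
  have /eq_card-> : finvect_type L =i zs by move=> z; rewrite in_zs defEm memvf.
  apply: succn_inj; rewrite (card_uniqP _) //= -(size_prod_XsubC _ id).
  by rewrite -(eqp_size DzP) size_polyDl size_polyXn // size_polyN size_polyX.
have dimL : \dim {:L} = N.
  apply: (expnI q_gt1); rewrite -/Q -cardL.
  by rewrite -(@card_vspacef K (finvect_type L) (Vector.class L)) card_vspace.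
by exists L, (gal_repr a); split=> // x; rewrite Da ?memvf.
Qed.

(** * Rank bounds from linearized polynomials *)

(** The left kernel of A has q^(n - rank A) elements, and psi sends them to
    distinct roots of P, which has at most q^r roots. *)
Lemma rank_ge_roots (K : finFieldType) (E : fieldExtType K) (n r : nat)
    (A : 'M[K]_n) (psi : 'rV[K]_n -> E) (P : {poly E}) :
    P != 0 -> (size P <= (#|K| ^ r).+1)%N ->
    (forall u, u *m A = 0 -> root P (psi u)) ->
    (forall u v, u *m A = 0 -> v *m A = 0 -> psi u = psi v -> u = v) ->
  (n <= \rank A + r)%N.
Proof.
move=> nzP szP rootP injpsi; set B := row_base (kermx A).
have kerB (v : 'rV_(\rank (kermx A))) : v *m B *m A = 0.
  apply/eqP; rewrite -sub_kermx; apply: submx_trans (submxMl _ _) _.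
  by rewrite eq_row_base.
have freeB : row_free B by apply: row_base_free.
pose s := [seq psi (v *m B) | v in [set: 'rV[K]_(\rank (kermx A))]].
have Us : uniq s.
  rewrite map_inj_in_uniq ?enum_uniq // => v w _ _ /injpsi.
  by move=> /(_ (kerB v) (kerB w)) /(row_free_inj freeB).
have rs : all (root P) s by apply/allP=> _ /mapP[v _ ->]; apply: rootP.
have := max_poly_roots nzP rs Us.
rewrite size_map -cardE cardsT card_mx mul1n mxrank_ker => lts.
have : (#|K| ^ (n - \rank A) <= #|K| ^ r)%N by rewrite -ltnS (leq_trans lts).
by rewrite leq_exp2l ?finNzRing_gt1 // leq_subLR.
Qed.

Lemma linear_image_code (K : fieldType) (V : vectType K) (n d : nat)
    (f : V -> 'M[K]_n) : (0 < d)%N -> linear f ->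
    (forall v, v != 0 -> (d <= \rank (f v))%N) ->
  exists C : {vspace 'M[K]_n},
    [/\ forall A, A \in C -> exists v, A = f v, \dim C = \dim {:V}
      & forall A, A \in C -> A != 0 -> (d <= \rank A)%N].
Proof.
move=> d_gt0 lin_f rkf.
pose F : {linear V -> 'M[K]_n} :=
  HB.pack f (GRing.isLinear.Build K V 'M[K]_n *:%R f lin_f).
have FE v : linfun F v = f v by rewrite lfunE.
exists (limg (linfun F)); split=> [A||A].
- by case/memv_imgP=> v _ ->; exists v; rewrite FE.
- apply/limg_dim_eq/eqP; rewrite capfv -subv0; apply/subvP=> v.
  rewrite memv_ker FE memv0; apply: contraLR => /rkf.
  by rewrite -mxrank_eq0 -lt0n; apply: leq_trans.
case/memv_imgP=> v _ ->; rewrite FE => nz_fv; apply: rkf.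
by apply: contraNneq nz_fv => ->; rewrite -FE linear0.
Qed.

(** Linearized polynomials: if q is the cardinal of a subfield K of R, their
    evaluation maps are K-linear. *)
Definition linpoly (R : nzRingType) (q k : nat) (a : 'I_k -> R) : {poly R} :=
  \sum_(l < k) a l *: 'X^(q ^ l).

Lemma horner_linpoly (R : comNzRingType) q k (a : 'I_k -> R) x :
  (linpoly q a).[x] = \sum_(l < k) a l * x ^+ (q ^ l).
Proof.
by rewrite horner_sum; apply: eq_bigr => l _; rewrite hornerZ hornerXn.
Qed.

Lemma size_linpoly (R : nzRingType) q k (a : 'I_k -> R) :
  (0 < q)%N -> (size (linpoly q a) <= (q ^ k.-1).+1)%N.
Proof.
move=> q_gt0; apply: leq_trans (size_sum _ _ _) _; apply/bigmax_leqP => l _.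
apply: leq_trans (size_scale_leq _ _) _; rewrite size_polyXn ltnS.
by rewrite leq_pexp2l // -ltnS prednK // (leq_trans _ (ltn_ord l)).
Qed.

Lemma linpoly_neq0 (R : nzRingType) q k (a : 'I_k -> R) l :
  (1 < q)%N -> a l != 0 -> linpoly q a != 0.
Proof.
move=> q_gt1; apply: contraNneq => /(congr1 (fun p : {poly R} => p`_(q ^ l))).
rewrite coef_sum coef0 (bigD1 l) //= coefZ coefXn eqxx mulr1 big1 ?addr0.
  by move->.
move=> j neq_jl; rewrite coefZ coefXn eqn_exp2l // eq_sym.
by rewrite (negPf (_ : j != l :> nat)) ?mulr0.
Qed.

(** For phi the Frobenius map, this is the evaluation map of [linpoly],
    packaged as a linear endomorphism so that it has a matrix. *)
Definition linmap (K : fieldType) (E : fieldExtType K) (phi : 'End(E)) k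
    (a : {ffun 'I_k -> E}) : 'End(E) :=
  \sum_l (amull (a l) \o iter l (fun f => phi \o f)%VF \1)%VF.

Lemma linmapE (K : fieldType) (E : fieldExtType K) (phi : 'End(E)) q k
    (a : {ffun 'I_k -> E}) x :
  (forall y, phi y = y ^+ q) -> linmap phi a x = (linpoly q a).[x].
Proof.
move=> phiE; rewrite horner_linpoly sum_lfunE; apply: eq_bigr => l _.
rewrite lfunE /= lfunE /=; congr (_ * _); elim: (val l) => [|i IHi] /=.
  by rewrite lfunE expr1.
by rewrite lfunE /= IHi phiE -exprM expnSr.
Qed.

Lemma linmap_linear (K : fieldType) (E : fieldExtType K) (phi : 'End(E)) k :
  linear (@linmap K E phi k).
Proof.
move=> c u v; rewrite scaler_sumr -big_split /=; apply: eq_bigr => l _.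
by rewrite !ffunE linearP /= comp_lfunDl comp_lfunZl.
Qed.

Lemma ffun_neq0 (E : nmodType) k (a : {ffun 'I_k -> E}) :
  a != 0 -> exists l, a l != 0.
Proof.
move=> nz_a; apply/existsP; apply: contraNT nz_a.
rewrite negb_exists => /forallP a0; apply/eqP/ffunP=> l.
by rewrite ffunE; apply/eqP; rewrite -[_ == _]negbK a0.
Qed.

(** Matrices of the evaluation maps of the linearized polynomials with
    N - d + 1 coefficients: such a polynomial has at most q^(N - d) roots, so
    its evaluation map has a kernel of dimension at most N - d. *)
Lemma Gabidulin_code (K : finFieldType) (N d : nat) : (0 < d <= N)%N ->
  exists G : {vspace 'M[K]_N},
    \dim G = ((N - d.-1) * N)%N /\
    forall A, A \in G -> A != 0 -> (d <= \rank A)%N.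
Proof.
case/andP=> d_gt0 le_dN.
have [E [phi [dimE phiE]]] :=
  ex_extension_Frobenius K (leq_trans d_gt0 le_dN).
subst N; pose b := vbasis {:E}; have b_basis : basis_of {:E} b := vbasisP _.
set N := \dim {:E} in le_dN *.
pose k := (N - d.-1)%N; have k_gt0 : (0 < k)%N by rewrite subn_gt0; lia.
pose Phi (a : {ffun 'I_k -> E}) := mxof b b (linmap phi a).
have lin_Phi : linear Phi by move=> c u v; rewrite /Phi linmap_linear linearP.
have [|G [_ dimG rkG]] := linear_image_code d_gt0 lin_Phi; last first.
  by exists G; split=> //; rewrite dimG dimvf /dim /= card_ord /k /N !dimvf.
move=> a nz_a; have [l nz_al] := ffun_neq0 nz_a.
have q_gt1 : (1 < #|K|)%N by apply: finNzRing_gt1.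
suffices : (N <= \rank (Phi a) + k.-1)%N by rewrite /k; lia.
apply: (@rank_ge_roots K E N k.-1 (Phi a) (vecof b) (linpoly #|K| a)).
- exact: linpoly_neq0 nz_al.
- exact: size_linpoly (ltnW q_gt1).
- move=> u; rewrite mul_mxof /root -(linmapE _ _ phiE) => /eqP.
  by rewrite rVof_eq0.
by move=> u v _ _; apply: (can_inj (vecofK b_basis)).
Qed.

(** * Codes with prescribed support *)

Lemma card_ord_itv (n a b : nat) :
  (b <= n)%N -> #|[set i : 'I_n | (a <= i < b)%N]| = (b - a)%N.
Proof.
move=> le_bn; rewrite -sum1dep_card.
rewrite -(big_mkord (fun i => a <= i < b)%N (fun=> 1%N)).
rewrite (eq_bigl (fun i => (a <= i) && (i < b))%N) //.
rewrite -(big_nat_widen _ _ _ (fun i => a <= i)%N) //.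
rewrite -(big_nat_widenl _ _ _ xpredT) //.
by rewrite sum_nat_const_nat muln1.
Qed.

Lemma dim_supported_le (K : fieldType) (n1 n2 : nat) (S : {set 'I_n1 * 'I_n2})
    (U : {vspace 'M[K]_(n1, n2)}) :
    (forall A, A \in U -> forall i j, (i, j) \notin S -> A i j = 0) ->
  (\dim U <= #|S|)%N.
Proof.
move=> suppU; pose X := [seq (delta_mx p.1 p.2 : 'M[K]_(n1, n2)) | p in S].
have sUX : (U <= <<X>>)%VS.
  apply/subvP=> A /suppU suppA; rewrite (matrix_sum_delta A).
  rewrite pair_bigA /=; apply: rpred_sum => -[i j] _ /=.
  have [Sij|/suppA->] := boolP ((i, j) \in S); last by rewrite scale0r rpred0.
  rewrite rpredZ // memv_span //; apply/mapP.
  by exists (i, j); rewrite ?mem_enum.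
apply: leq_trans (dimvS sUX) _; apply: leq_trans (dim_span _) _.
by rewrite size_map -cardE.
Qed.

(** Vanishing at the positions of S imposes #|S| linear conditions. *)
Lemma dim_vanishing_ge (K : fieldType) (n1 n2 : nat) (S : {set 'I_n1 * 'I_n2})
    (U : {vspace 'M[K]_(n1, n2)}) :
  exists W : {vspace 'M[K]_(n1, n2)},
    [/\ (W <= U)%VS, (\dim U <= \dim W + #|S|)%N
      & forall A, A \in W -> forall i j, (i, j) \in S -> A i j = 0].
Proof.
pose f (A : 'M[K]_(n1, n2)) : 'M[K]_(n1, n2) :=
  \matrix_(i, j) (if (i, j) \in S then A i j else 0).
have lin_f : linear f.
  move=> c A B; apply/matrixP=> i j; rewrite !mxE.
  by case: ifP => _; rewrite ?mulr0 ?addr0.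
pose F : {linear 'M[K]_(n1, n2) -> 'M[K]_(n1, n2)} :=
  HB.pack f (GRing.isLinear.Build K 'M[K]_(n1, n2) 'M[K]_(n1, n2) *:%R f lin_f).
exists (U :&: lker (linfun F))%VS; split=> [||A].
- exact: capvSl.
- rewrite -(limg_ker_dim (linfun F) U) leq_add2l; apply: dim_supported_le => A.
  by case/memv_imgP=> B _ -> i j /negPf S'ij; rewrite lfunE mxE S'ij.
case/memv_capP=> _; rewrite memv_ker lfunE => /eqP FA0 i j Sij.
by have /matrixP/(_ i j) := FA0; rewrite !mxE Sij.
Qed.

(** A Gabidulin code is placed in the N x N square cut out by the rows rho and
    the columns kappa, and its matrices are then forced to vanish at the
    N^2 - #|D| positions of the square outside D.  When N < d the bound is
    reached by the zero code, since then #|D| <= N^2 <= (d - 1) N. *)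
Lemma supported_Gabidulin_code (K : finFieldType) (n N d : nat)
    (rho kappa : 'I_N -> 'I_n) (D : {set 'I_n * 'I_n}) :
    injective rho -> injective kappa -> (0 < d)%N ->
    (forall p, p \in D -> exists i j, p = (rho i, kappa j)) ->
  exists C : {vspace 'M[K]_n},
    [/\ forall A, A \in C -> supported_on D A,
        forall A, A \in C -> A != 0 -> (d <= \rank A)%N
      & (#|D| <= \dim C + d.-1 * N)%N].
Proof.
move=> inj_rho inj_kappa d_gt0 sub_rect.
pose bad := [set p : 'I_N * 'I_N | (rho p.1, kappa p.2) \notin D].
have cardD : (#|D| + #|bad| <= N * N)%N.
  have -> : (N * N = #|bad| + #|~: bad|)%N.
    by rewrite cardsC card_prod !card_ord.
  rewrite addnC leq_add2l.
  apply: leq_trans (leq_imset_card (fun p => (rho p.1, kappa p.2)) _).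
  apply/subset_leq_card/subsetP=> p Dp; have [i [j Dij]] := sub_rect p Dp.
  by apply/imsetP; exists (i, j); rewrite // !inE negbK -Dij.
have [le_dN|lt_Nd] := leqP d N; last first.
  exists 0%VS; split=> [A|A|]; rewrite ?memv0 ?dimv0.
  - by move/eqP-> => x y _; rewrite mxE.
  - by move/eqP->; rewrite eqxx.
  apply: leq_trans (leq_trans (leq_addr _ _) cardD) _.
  by rewrite add0n leq_mul2r; lia.
have [|G [dimG rkG]] := @Gabidulin_code K N d; first by rewrite d_gt0.
have [W [sWG dimW vanW]] := dim_vanishing_ge bad G.
(* A |-> P^T A Q writes A into the rows rho and the columns kappa. *)
pose P : 'M[K]_(N, n) := \matrix_(i, x) (rho i == x)%:R.
pose Q : 'M[K]_(N, n) := \matrix_(i, x) (kappa i == x)%:R.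
have orth (tau : 'I_N -> 'I_n) (T : 'M[K]_(N, n)) :
  injective tau -> T = \matrix_(i, x) (tau i == x)%:R -> T *m T^T = 1%:M.
  move=> inj_tau ->; apply/matrixP=> i j; rewrite !mxE (bigD1 (tau i)) //=.
  rewrite !mxE eqxx mul1r big1 ?addr0 => [|x /negPf ne].
    by rewrite (inj_eq inj_tau) eq_sym.
  by rewrite !mxE eq_sym ne mul0r.
pose f (A : 'M[K]_N) : 'M[K]_n := P^T *m A *m Q.
have lin_f : linear f.
  by move=> c A B; rewrite /f mulmxDr mulmxDl -scalemxAr -scalemxAl.
pose F : {linear 'M[K]_N -> 'M[K]_n} :=
  HB.pack f (GRing.isLinear.Build K 'M[K]_N 'M[K]_n *:%R f lin_f).
have fK A : P *m f A *m Q^T = A.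
  by rewrite /f !mulmxA (orth rho) // mul1mx -mulmxA (orth kappa) // mulmx1.
have rkf A : (\rank A <= \rank (f A))%N.
  by rewrite -{1}[A]fK; apply: leq_trans (mxrankM_maxl _ _) (mxrankM_maxr _ _).
exists (linfun F @: W)%VS; split=> [A|A|].
- case/memv_imgP=> B WB -> x y D'xy; rewrite lfunE /= /f !mxE big1 // => j _.
  rewrite !mxE; have [Dy|] := eqVneq (kappa j) y; last by rewrite mulr0.
  rewrite mulr1 big1 // => i _; rewrite !mxE.
  have [Dx|] := eqVneq (rho i) x; last by rewrite mul0r.
  rewrite mul1r; apply: (vanW _ WB).
  by rewrite inE /= Dx Dy.
- case/memv_imgP=> B WB ->; rewrite lfunE /= => nz_fB.
  apply: leq_trans (rkf B); apply: rkG; first exact: (subvP sWG).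
  by apply: contraNneq nz_fB => ->; rewrite /f mulmx0 mul0mx.
rewrite limg_dim_eq.
  have DN : ((N - d.-1) * N + d.-1 * N = N * N)%N.
    by rewrite -mulnDl subnK //; lia.
  rewrite -(leq_add2r #|bad|); apply: leq_trans cardD _.
  by rewrite -DN addnAC leq_add2r -dimG.
apply/eqP; rewrite -subv0; apply/subvP=> A /memv_capP[_].
rewrite memv_ker lfunE /= memv0 => /eqP fA0.
by rewrite -[A]fK [f A]fA0 mulmx0 mul0mx.
Qed.

Local Close Scope ring_scope.

(** * Ferrers diagrams and the bound nu *)

Lemma Ferrers_mono n (D : {set 'I_n * 'I_n}) (x x' y y' : 'I_n) :
  is_Ferrers D -> (x, y) \in D -> x' <= x -> y <= y' -> (x', y') \in D.
Proof.
case=> right_closed up_closed Dxy le_x le_y.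
have {le_x} Dx'y : (x', y) \in D.
  move: {2}(x - x') (erefl (x - x')) => k Dk.
  elim: k x Dk Dxy le_x => [|k IHk] x Dk Dxy le_x.
    rewrite (_ : x' = x) //; apply/val_inj/eqP.
    by rewrite eqn_leq le_x -subn_eq0 Dk.
  have lt_x1 : x.-1 < n by apply: leq_ltn_trans (leq_pred _) (ltn_ord x).
  apply: (IHk (Ordinal lt_x1)) => /=; try lia.
  by apply: up_closed Dxy _ => /=; lia.
move: {2}(y' - y) (erefl (y' - y)) => k Dk.
elim: k y Dk Dx'y le_y {Dxy} => [|k IHk] y Dk Dxy le_y.
  rewrite (_ : y' = y) //; apply/val_inj/eqP.
  by rewrite eqn_leq le_y -subn_eq0 Dk.
have lt_y1 : y.+1 < n by have := ltn_ord y'; lia.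
apply: (IHk (Ordinal lt_y1)) => /=; try lia.
by apply: right_closed Dxy _.
Qed.

Lemma Ferrers_col_card n (D : {set 'I_n * 'I_n}) (x y : 'I_n) :
  is_Ferrers D -> (x, y) \in D -> x < col_card D y.
Proof.
move=> FD Dxy; rewrite -[x.+1]subn0 -(card_ord_itv 0 (ltn_ord x)).
apply/subset_leq_card/subsetP=> x'; rewrite !inE /= ltnS => le_x'.
exact: Ferrers_mono Dxy le_x' _.
Qed.

Lemma card_set_pairs (T1 T2 : finType) (S : {set T1 * T2}) :
  #|S| = \sum_x \sum_y ((x, y) \in S).
Proof.
rewrite pair_bigA /= -sum1_card big_mkcond /=; apply: eq_bigr => -[x y] _.
by case: (_ \in S).
Qed.

Lemma card_by_columns n (S : {set 'I_n * 'I_n}) :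
  #|S| = \sum_(y < n) #|[set x | (x, y) \in S]|.
Proof.
rewrite card_set_pairs exchange_big; apply: eq_bigr => y _.
rewrite -sum1dep_card [RHS]big_mkcond.
by apply: eq_bigr => x _; case: (_ \in S).
Qed.

(** Each column of a Ferrers diagram is an initial segment, so removing the
    first d - j rows leaves col_card D y - (d - j) of its elements.  The count
    is stated with nu at d + 1 because the d - j rows and j columns left out
    are d lines in all, one more than in nu at d. *)
Lemma card_Ferrers_corner_le n (D : {set 'I_n * 'I_n}) d j :
  is_Ferrers D -> j <= d ->
  #|[set p in D | (d - j <= p.1) && (p.2 < n - j)]| <= nu D d.+1 j.
Proof.
move=> FD le_jd; rewrite card_by_columns /nu [leqRHS]big_mkcond /=.
apply: leq_sum => y _; case: ifPn => [lt_y|/negPf ge_y]; last first.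
  by rewrite (eq_card0 (A := [set x | _])) // => x; rewrite !inE /= ge_y !andbF.
have -> : col_card D y + 1 + j - d.+1 = col_card D y - (d - j) by lia.
have le_cn : col_card D y <= n by rewrite -[leqRHS]card_ord max_card.
rewrite -(card_ord_itv _ le_cn); apply/subset_leq_card/subsetP => x.
by rewrite !inE /= => /andP[Dxy /andP[-> _]]; apply: Ferrers_col_card.
Qed.

Lemma nu_ltS n (D : {set 'I_n * 'I_n}) d j :
  0 < nu D d j -> nu D d.+1 j < nu D d j.
Proof.
rewrite lt0n sum_nat_eq0 negb_forall => /existsP[y]; rewrite negb_imply.
case/andP=> lt_y nz_y; rewrite /nu (bigD1 y) //= [ltnRHS](bigD1 y) //=.
rewrite -addSn leq_add //; first by lia.
by apply: leq_sum => x _; lia.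
Qed.

Lemma nu_min_attained n (D : {set 'I_n * 'I_n}) d :
  0 < d -> exists2 j, j < d & nu_min D d = nu D d j.
Proof.
move=> d_gt0; rewrite /nu_min.
elim/big_ind: _ => [|_ _ [i lt_i ->] [j lt_j ->]|i _]; first by exists 0.
  by case: (leqP (nu D d i) (nu D d j)) => _; [exists i | exists j].
by exists i.
Qed.

(** A matrix supported on a rows and b columns is the sum of a matrix with at
    most a nonzero rows and one with at most b nonzero columns. *)
Lemma rank_le_crossing (K : fieldType) (n a b : nat) (A : 'M[K]_n) :
    (forall i j : 'I_n, a <= i -> j < n - b -> A i j = 0%R) ->
  \rank A <= a + b.
Proof.
move=> A0; have [le_an|/ltnW le_na] := leqP a n; last first.
  by apply: leq_trans (rank_leq_row A) (leq_trans le_na (leq_addr _ _)).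
have DA : A = (pid_mx a *m A + copid_mx a *m A *m copid_mx (n - b))%R.
  suffices CAP0 : (copid_mx a *m A *m (pid_mx (n - b) : 'M_n) = 0)%R.
    by rewrite [RHS]addrC mulmxBr mulmx1 CAP0 subr0 mulmxBl mul1mx subrK.
  apply/matrixP=> x y; rewrite !mxE big1 // => k _; rewrite !mxE.
  have [/andP[_ lt_k]|_] := boolP ((k == y :> nat) && _); last exact: mulr0.
  rewrite mulr1 big1 // => l _; rewrite !mxE.
  have [le_a|lt_a] := leqP a l; first by rewrite A0 ?mulr0.
  have [->|neq_xl] := eqVneq x l; first by rewrite eqxx lt_a subrr mul0r.
  by rewrite (negPf (_ : x != l :> nat)) ?subr0 ?mul0r.
rewrite DA; apply: leq_trans (mxrank_add _ _) (leq_add _ _).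
  by apply: leq_trans (mxrankM_maxl _ _) _; rewrite rank_pid_mx.
apply: leq_trans (mxrankM_maxr _ _) _.
by rewrite rank_copid_mx ?leq_subr //; lia.
Qed.

(** The Singleton-type bound is what makes the minimum rank exactly d: if
    nu_min D d = nu D d j is positive, then nu D (d + 1) j is smaller, so a
    code of dimension nu_min D d has a nonzero matrix vanishing on all
    positions of D outside the first d - j rows and the last j columns. *)
Lemma MFD_of_large_code (K : finFieldType) n (D : {set 'I_n * 'I_n}) d
    (C0 : {vspace 'M[K]_n}) :
    is_Ferrers D -> 0 < d ->
    (forall A, A \in C0 -> supported_on D A) ->
    (forall A, A \in C0 -> A != 0%R -> d <= \rank A) ->
    nu_min D d <= \dim C0 ->
  exists C : {vspace 'M[K]_n}, is_MFD_code D (nu_min D d) d C.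
Proof.
move=> FD d_gt0 suppC0 rkC0 le_nu.
pose C := <<take (nu_min D d) (vbasis C0)>>%VS.
have sCC0 : (C <= C0)%VS.
  by apply/span_subvP=> A /mem_take; apply: vbasis_mem.
have dimC : \dim C = nu_min D d.
  have freeC : free (take (nu_min D d) (vbasis C0)).
    have := basis_free (vbasisP C0).
    by rewrite -{1}(cat_take_drop (nu_min D d) (vbasis C0)) => /catl_free.
  by rewrite (eqnP freeC) size_takel // size_tuple.
exists C; split=> //; split=> // [A /(subvP sCC0)/suppC0 //|].
have [nu0|nu_gt0] := posnP (nu_min D d).
  by left; apply/eqP; rewrite -dimv_eq0 dimC nu0.
right; split; last by move=> A /(subvP sCC0) C0A; apply: rkC0.
have [j lt_jd Dnu] := nu_min_attained D d_gt0.
(* Codewords vanishing on S live on the first d - j rows and last j columns. *)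
pose S := [set p in D | (d - j <= p.1) && (p.2 < n - j)].
have [W [sWC dimW vanW]] := dim_vanishing_ge S C.
have W_gt0 : 0 < \dim W.
  have := card_Ferrers_corner_le FD (ltnW lt_jd).
  have := @nu_ltS n D d j.
  by move: dimW; rewrite -/S -Dnu dimC; lia.
have [A WA nzA] : exists2 A, A \in W & A != 0%R.
  exists (vpick W); first exact: memv_pick.
  by rewrite vpick0 -dimv_eq0 -lt0n.
have CA := subvP sWC A WA; have C0A := subvP sCC0 A CA.
exists A; split=> //; apply/eqP; rewrite eqn_leq rkC0 // andbT.
rewrite -[leqRHS](subnK (ltnW lt_jd)); apply: rank_le_crossing => x y le_x lt_y.
have [Dxy|/suppC0->//] := boolP ((x, y) \in D).
by apply: (vanW _ WA); rewrite !inE Dxy le_x.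
Qed.

(** * Block matrices and the staircase code *)

Local Open Scope ring_scope.

Lemma blk_subproof (s m : nat) (i : 'I_s) (k : 'I_m) : (i * m + k < s * m)%N.
Proof.
apply: (@leq_trans (i.+1 * m)); first by rewrite mulSn addnC ltn_add2r.
by rewrite leq_mul2r ltn_ord orbT.
Qed.

Definition blk (s m : nat) (i : 'I_s) (k : 'I_m) : 'I_(s * m) :=
  Ordinal (blk_subproof i k).

Lemma blk_quo_subproof (s m : nat) (x : 'I_(s * m)) : (x %/ m < s)%N.
Proof.
have := leq_ltn_trans (leq0n x) (ltn_ord x).
by rewrite muln_gt0 => /andP[_ m_gt0]; rewrite ltn_divLR.
Qed.

Definition blk_quo (s m : nat) (x : 'I_(s * m)) : 'I_s :=
  Ordinal (blk_quo_subproof x).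

Lemma blk_rem_subproof (s m : nat) (x : 'I_(s * m)) : (x %% m < m)%N.
Proof.
have := leq_ltn_trans (leq0n x) (ltn_ord x).
by rewrite muln_gt0 ltn_mod => /andP[].
Qed.

Definition blk_rem (s m : nat) (x : 'I_(s * m)) : 'I_m :=
  Ordinal (blk_rem_subproof x).

Lemma blkK (s m : nat) (x : 'I_(s * m)) : blk (blk_quo x) (blk_rem x) = x.
Proof. by apply: val_inj; rewrite /= -divn_eq. Qed.

Lemma blk_quoK (s m : nat) (i : 'I_s) (k : 'I_m) : blk_quo (blk i k) = i.
Proof.
apply: val_inj; rewrite /= divnMDl ?divn_small ?addn0 //.
exact: leq_ltn_trans (ltn_ord k).
Qed.

Lemma blk_remK (s m : nat) (i : 'I_s) (k : 'I_m) : blk_rem (blk i k) = k.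
Proof. by apply: val_inj; rewrite /= modnMDl modn_small. Qed.

Lemma big_blk (R : Type) (idx : R) (op : Monoid.com_law idx) (s m : nat)
    (F : 'I_(s * m) -> R) :
  \big[op/idx]_x F x = \big[op/idx]_i \big[op/idx]_k F (blk i k).
Proof.
rewrite pair_bigA /= (reindex (fun p : 'I_s * 'I_m => blk p.1 p.2)) //.
exists (fun x => (blk_quo x, blk_rem x)) => [[i k]|x] _ /=; last exact: blkK.
by rewrite blk_quoK blk_remK.
Qed.

Definition row_blk (R : Type) (s m : nat) (u : 'rV[R]_(s * m)) (i : 'I_s) :
  'rV[R]_m := \row_k u 0 (blk i k).

Lemma row_blk_inj (R : Type) (s m : nat) (u v : 'rV[R]_(s * m)) :
  row_blk u =1 row_blk v -> u = v.
Proof.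
move=> eq_uv; apply/rowP=> x; rewrite -[x]blkK.
by have /rowP/(_ (blk_rem x)) := eq_uv (blk_quo x); rewrite !mxE.
Qed.

Definition matrix_of_blocks (R : Type) (s m : nat)
    (B : 'I_s -> 'I_s -> 'M[R]_m) : 'M[R]_(s * m) :=
  \matrix_(x, y) B (blk_quo x) (blk_quo y) (blk_rem x) (blk_rem y).

Lemma row_blk_mul (R : pzRingType) (s m : nat) (B : 'I_s -> 'I_s -> 'M[R]_m)
    (u : 'rV[R]_(s * m)) (j : 'I_s) :
  row_blk (u *m matrix_of_blocks B) j = \sum_i row_blk u i *m B i j.
Proof.
apply/rowP=> k; rewrite !mxE big_blk summxE; apply: eq_bigr => i _.
by rewrite !mxE; apply: eq_bigr => l _; rewrite !mxE !blk_quoK !blk_remK.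
Qed.

Definition bidiagonal_mx (R : pzRingType) (s m : nat) (F G : 'M[R]_m) :
    'M[R]_(s * m) :=
  matrix_of_blocks (fun i j : 'I_s =>
    if i == j then F else if i.+1 == j :> nat then G else 0).

(** Reading the equation u B = 0 by block columns from the left, f kills the
    first block of u, and the next column then shows that this block is 0 by
    the hypothesis on f and g; hence f kills the second block, and so on.
    Only the last block escapes, as no column follows it. *)
Lemma bidiagonal_ker (K : fieldType) (E : fieldExtType K) (s : nat)
    (e : (\dim {:E}).-tuple E) (f g : 'End(E)) (u : 'rV[K]_(s * \dim {:E})) :
    basis_of {:E} e ->
    (forall x y, f x = 0 -> g x + f y = 0 -> x = 0) ->
    u *m bidiagonal_mx s (mxof e e f) (mxof e e g) = 0 ->
  forall i : 'I_s, ((i.+1 < s)%N -> row_blk u i = 0)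
                    /\ f (vecof e (row_blk u i)) = 0.
Proof.
move=> e_basis fg; rewrite /bidiagonal_mx.
set B := (B in matrix_of_blocks B) => uB0.
have col_eq j : \sum_i row_blk u i *m B i j = 0.
  by rewrite -row_blk_mul uB0; apply/rowP=> k; rewrite !mxE.
have f_eq0 (j : 'I_s) :
    (forall i : 'I_s, i.+1 = j :> nat -> row_blk u i = 0) ->
  f (vecof e (row_blk u j)) = 0.
  move=> u0; apply/eqP; rewrite -(rVof_eq0 e_basis) -mul_mxof; apply/eqP.
  have := col_eq j; rewrite /B (bigD1 j) //= eqxx big1 ?addr0 // => i /negPf->.
  by case: eqP => [/u0->|_]; rewrite ?mul0mx ?mulmx0.
move=> i; have [n le_in] := ubnP i; elim: n i le_in => // n IHn i.
rewrite ltnS => le_in.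
have f_ui : f (vecof e (row_blk u i)) = 0.
  by apply: f_eq0 => j Dj; apply: (IHn j _).1; rewrite Dj // ltn_ord.
split=> // lt_is; apply/eqP; rewrite -(vecof_eq0 e_basis); apply/eqP.
pose i1 := Ordinal lt_is.
apply: (fg _ (vecof e (row_blk u i1)) f_ui).
apply/eqP; rewrite -(rVof_eq0 e_basis) linearD /= -!mul_mxof; apply/eqP.
have neq_i : i != i1 by rewrite -val_eqE /= ltn_eqF.
have := col_eq i1; rewrite /B (bigD1 i1) //= (bigD1 i) //= (negPf neq_i) !eqxx.
rewrite big1 ?addr0 1?addrC // => j /andP[/negPf-> ne_j].
case: eqP => [[Dj]|_]; last by rewrite mulmx0.
by case/eqP: ne_j; apply: val_inj.
Qed.

(** The map z - phi z kills 1, so it is not injective, hence not surjective. *)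
Lemma ex_nonimage_sub_id (K : fieldType) (E : fieldExtType K)
    (phi : 'End(E)) :
  phi 1 = 1 -> exists c, forall z, c + phi z != z.
Proof.
move=> phi1; pose h := (\1 - phi)%VF.
have hE z : h z = z - phi z by rewrite /h lfunE /= lfunE /= opp_lfunE.
have /subvPn[c _ h'c] : ~~ ({:E} <= limg h)%VS.
  apply/negP=> /dimvS; have := limg_ker_dim h {:E}; rewrite capfv => <-.
  rewrite -[leqRHS]add0n leq_add2r leqn0 dimv_eq0 => /eqP ker0.
  have : 1 \in lker h by rewrite memv_ker hE phi1 subrr.
  by rewrite ker0 memv0 oner_eq0.
exists c => z; apply: contraNneq h'c => Dz.
have -> : c = h z by rewrite hE -{1}Dz addrK.
exact: memv_img (memvf _).
Qed.

(** With f x = a0 x + a1 x^q and g x = c a1 x^q, suppose f x = 0 and x is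
    nonzero.  Then a0 x = - a1 x^q, and with y = z x the equation
    g x + f y = 0 becomes a1 x^q (c + z^q - z) = 0.  For k = 1 the
    coefficient a1 is absent and f is already injective.  Writing
    g as c (f x - a0 x) covers both values of k. *)
Lemma linpoly_bidiagonal (E : fieldType) (q k : nat) (k_gt0 : (0 < k)%N)
    (a : {ffun 'I_k -> E}) (c x y : E) : (k <= 2)%N ->
    (forall z, c + z ^+ q != z) -> a != 0 ->
    \sum_(l < k) a l * x ^+ (q ^ l) = 0 ->
    c * (\sum_(l < k) a l * x ^+ (q ^ l) - a (Ordinal k_gt0) * x)
      + \sum_(l < k) a l * y ^+ (q ^ l) = 0 ->
  x = 0.
Proof.
move=> k_le2 c_nonimage nz_a fx0; rewrite fx0 sub0r.
have [//|nz_x] := eqVneq x 0; have [l nz_al] := ffun_neq0 nz_a.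
case: k => [|[|[|k]]] // in k_gt0 a k_le2 nz_a l nz_al fx0 *.
  move: fx0; rewrite big_ord1 expr1 (ord1 l) in nz_al *.
  by move/eqP; rewrite mulf_eq0 (negPf nz_x) orbF; move: nz_al => /[swap] ->.
have -> : Ordinal k_gt0 = ord0 by apply: val_inj.
move: fx0; rewrite !big_ord_recl !big_ord0 /= !addr0 !expr1.
set a0 := a ord0; set a1 := a _ => fx0 eq0.
have nz_a1 : a1 != 0.
  apply: contraNneq nz_al => a1_0; move: fx0; rewrite a1_0 mul0r addr0 => /eqP.
  rewrite mulf_eq0 (negPf nz_x) orbF => a0_0.
  by case: (unliftP ord0 l) => [l' ->|->] //; rewrite (ord1 l') -/a1 a1_0.
have Da0 : a0 * x = - (a1 * x ^+ q) by apply/eqP; rewrite -addr_eq0 fx0.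
have : a1 * x ^+ q * (c + (y / x) ^+ q - y / x) = 0.
  move: eq0; rewrite -{1 2}[y](divfK nz_x) expn1 exprMn; set z := y / x.
  rewrite (mulrCA a0) (mulrCA a1) Da0 opprK => eq0.
  by rewrite -eq0; ring.
move/eqP; rewrite !mulf_eq0 (negPf nz_a1) expf_eq0 (negPf nz_x) andbF /=.
by rewrite subr_eq0 (negPf (c_nonimage _)).
Qed.

(** The left kernel of the bidiagonal block matrix embeds, through its last
    block, in the set of roots of a linearized polynomial with k
    coefficients, so it has dimension at most k - 1. *)
Lemma staircase_code (K : finFieldType) (s m k : nat)
    (D : {set 'I_(s * m) * 'I_(s * m)}) : (0 < m)%N -> (0 < k <= 2)%N ->
    (k <= s * m)%N ->
    (forall x y : 'I_(s * m), (x %/ m <= y %/ m)%N -> (x, y) \in D) ->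
  exists C : {vspace 'M[K]_(s * m)},
    [/\ forall A, A \in C -> supported_on D A,
        forall A, A \in C -> A != 0 -> (s * m - k.-1 <= \rank A)%N
      & \dim C = (k * m)%N].
Proof.
move=> m_gt0 /andP[k_gt0 k_le2] le_k_sm upD.
have [E [phi [dimE phiE]]] := ex_extension_Frobenius K m_gt0.
subst m; pose e := vbasis {:E}; have e_basis : basis_of {:E} e := vbasisP _.
have q_gt1 : (1 < #|K|)%N by apply: finNzRing_gt1.
have [c c_nonimage] : exists c, forall z, c + phi z != z.
  by apply: ex_nonimage_sub_id; rewrite phiE expr1n.
pose o : 'I_k := Ordinal k_gt0.
pose f (a : {ffun 'I_k -> E}) := linmap phi a.
pose g (a : {ffun 'I_k -> E}) := (amull c \o (f a - amull (a o)))%VF.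
have lin_g : linear g.
  move=> t a b; rewrite /g /f linmap_linear !ffunE linearP /=.
  by rewrite opprD addrACA -scalerBr comp_lfunDr comp_lfunZr.
pose Phi a := bidiagonal_mx s (mxof e e (f a)) (mxof e e (g a)).
have lin_Phi : linear Phi.
  move=> t a b; apply/matrixP=> x y; rewrite !mxE.
  case: eqP => _; first by rewrite /f linmap_linear linearP !mxE.
  case: eqP => _; first by rewrite lin_g linearP !mxE.
  by rewrite !mxE mulr0 addr0.
have fg a x y : a != 0 -> f a x = 0 -> g a x + f a y = 0 -> x = 0.
  move=> nz_a; rewrite /g lfunE /= lfunE /= add_lfunE opp_lfunE lfunE /=.
  rewrite /f !(linmapE _ _ phiE) !horner_linpoly.
  apply: (linpoly_bidiagonal k_le2 _ nz_a).
  by move=> z; rewrite -phiE.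
have [||C [CE dimC rkC]] :=
    @linear_image_code _ _ _ (s * \dim {:E} - k.-1) _ _ lin_Phi.
- by rewrite subn_gt0; lia.
- move=> a nz_a; rewrite leq_subLR addnC.
  have [l nz_al] := ffun_neq0 nz_a.
  have s_gt0 : (0 < s)%N by case: (s) le_k_sm; rewrite // mul0n; lia.
  have lt_s : (s.-1 < s)%N by rewrite prednK.
  apply: (@rank_ge_roots K E _ k.-1 (Phi a)
     (fun u => vecof e (row_blk u (Ordinal lt_s))) (linpoly #|K| a)).
  + exact: linpoly_neq0 nz_al.
  + exact: size_linpoly (ltnW q_gt1).
  + move=> u /(bidiagonal_ker e_basis (fun x y => fg a x y nz_a)).
    by move=> /(_ (Ordinal lt_s))[_ fu]; rewrite /root -(linmapE _ _ phiE) fu.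
  move=> u v /(bidiagonal_ker e_basis (fun x y => fg a x y nz_a)) keru.
  move=> /(bidiagonal_ker e_basis (fun x y => fg a x y nz_a)) kerv.
  move/(can_inj (vecofK e_basis)) => eq_last; apply: row_blk_inj => i.
  have [lt_i|ge_i] := ltnP i.+1 s; first by rewrite (keru i).1 ?(kerv i).1.
  suffices -> : i = Ordinal lt_s by [].
  by apply: val_inj => /=; have := ltn_ord i; lia.
exists C; split=> // [A /CE[a ->] x y D'xy|]; last first.
  by rewrite dimC !dimvf /dim /= card_ord.
have lt_yx : (y %/ \dim {:E} < x %/ \dim {:E})%N.
  by rewrite ltnNge; apply: contra D'xy => /upD.
rewrite mxE -val_eqE /= gtn_eqF //.
by rewrite gtn_eqF ?mxE // ltnW.
Qed.

Local Close Scope ring_scope.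

(** * Block Ferrers diagrams *)

Definition blocks_in (s m : nat) (D : {set 'I_(s * m) * 'I_(s * m)}) :
    {set 'I_s * 'I_s} := [set p | block m p.1 p.2 \subset D].

(** Block diagonals are numbered here by their distance e to the main one, so
    that no truncated subtraction occurs in the definition. *)
Definition diag_blocks_in (s m : nat) (D : {set 'I_(s * m) * 'I_(s * m)}) e :
    {set 'I_s * 'I_s} := [set p in blocks_in D | p.2 == e + p.1 :> nat].

Lemma mem_block s m (i j : 'I_s) (x y : 'I_(s * m)) :
  ((x, y) \in block m i j) = (blk_quo x == i) && (blk_quo y == j).
Proof.
have m_gt0 : 0 < m.
  by have := leq_ltn_trans (leq0n x) (ltn_ord x); rewrite muln_gt0 => /andP[].
rewrite inE /= -!val_eqE /= -!leq_divRL // -!ltn_divLR // !ltnS.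
by rewrite ![_ == _ :> nat]eqn_leq !(andbC (_ <= nat_of_ord _)).
Qed.

Lemma card_block_diag s m i (D : {set 'I_(s * m) * 'I_(s * m)}) :
  0 < m -> i <= s ->
  #|block_diag s m i :&: block_set D| = #|diag_blocks_in D (s - i)|.
Proof.
move=> m_gt0 le_is; pose k0 : 'I_m := Ordinal m_gt0.
have block_inj : injective (fun p : 'I_s * 'I_s => block m p.1 p.2).
  move=> [i1 j1] [i2 j2] /= /setP/(_ (blk i1 k0, blk j1 k0)).
  by rewrite !mem_block !blk_quoK !eqxx => /esym/andP[/eqP-> /eqP->].
rewrite -[RHS](card_imset _ block_inj); apply: eq_card => X.
apply/setIP/imsetP => [[/imsetP[p Hp ->] /imsetP[p' Hp' Dp]]|[p]].
  exists p => //; move/block_inj: Dp Hp Hp' => <-; rewrite !inE => /andP[_ ->].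
  by move->.
rewrite !inE => /andP[Bp Dp] ->; split; apply/imsetP; exists p; rewrite ?inE //.
rewrite Dp andbT; have := ltn_ord p.2; rewrite (eqP Dp).
by move: (nat_of_ord p.1) => x; lia.
Qed.

Lemma card_diag_blocks_le s m (D : {set 'I_(s * m) * 'I_(s * m)}) e :
  #|diag_blocks_in D e| <= s - e.
Proof.
rewrite -(subn0 (s - e)) -(card_ord_itv 0 (leq_subr e s)).
rewrite -(card_in_imset (f := fst) (D := diag_blocks_in D e)).
  apply/subset_leq_card/subsetP=> _ /imsetP[[i j] + ->]; rewrite !inE /=.
  by case/andP=> _ /eqP Dj; have := ltn_ord j; lia.
move=> [i j] [i' j']; rewrite !inE /= => /andP[_ /eqP Dj] /andP[_ /eqP Dj'] Di.
by rewrite Di (_ : j = j') //; apply: val_inj; rewrite /= Dj Dj' Di.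
Qed.

Lemma mem_block_Ferrers (s m : nat) (D : {set 'I_(s * m) * 'I_(s * m)}) x y :
    is_block_Ferrers D ->
  ((x, y) \in D) = ((blk_quo x, blk_quo y) \in blocks_in D).
Proof.
move=> FD; have Qxy : (x, y) \in block m (blk_quo x) (blk_quo y).
  by rewrite mem_block !eqxx.
rewrite inE /=; apply/idP/subsetP => [Dxy|/(_ _ Qxy)//].
case: (FD.2 (blk_quo x) (blk_quo y)) => [/setP/(_ (x, y))|<-]; last first.
  by move=> p /setIP[].
by rewrite inE Qxy Dxy inE.
Qed.

Lemma blocks_in_mono (s m : nat) (D : {set 'I_(s * m) * 'I_(s * m)})
    (i i' j j' : 'I_s) : 0 < m -> is_block_Ferrers D ->
  (i, j) \in blocks_in D -> i' <= i -> j <= j' -> (i', j') \in blocks_in D.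
Proof.
move=> m_gt0 FD Bij le_i le_j; pose k0 : 'I_m := Ordinal m_gt0.
have := @Ferrers_mono _ D (blk i k0) (blk i' k0) (blk j k0) (blk j' k0) FD.1.
rewrite !mem_block_Ferrers // !blk_quoK; apply=> //=.
  by rewrite leq_add2r leq_mul2r le_i orbT.
by rewrite leq_add2r leq_mul2r le_j orbT.
Qed.

Lemma card_block_Ferrers_upper (s m : nat) (D : {set 'I_(s * m) * 'I_(s * m)}) :
    is_block_Ferrers D ->
  #|[set p in D | blk_quo p.1 <= blk_quo p.2]|
    = m * m * \sum_(e < s) #|diag_blocks_in D e|.
Proof.
move=> FD; have -> : \sum_(e < s) #|diag_blocks_in D e|
    = \sum_(i < s) \sum_(j < s) (((i, j) \in blocks_in D) && (i <= j)).
  under eq_bigr => e _ do rewrite card_set_pairs.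
  rewrite exchange_big; apply: eq_bigr => i _.
  rewrite exchange_big; apply: eq_bigr => j _.
  have [le_ij|lt_ji] := leqP i j; last first.
    by rewrite andbF big1 // => e _; rewrite inE /= ltn_eqF ?andbF // ltn_addl.
  have lt_e : j - i < s by apply: leq_ltn_trans (leq_subr _ _) (ltn_ord j).
  rewrite andbT (bigD1 (Ordinal lt_e)) //= big1 => [|e ne_e].
    by rewrite addn0 [X in nat_of_bool X]inE /= subnK // eqxx andbT.
  rewrite inE /= [_ == _ :> nat](_ : _ = false) ?andbF //.
  by apply: contraNF ne_e => /eqP Dj; rewrite -val_eqE /= Dj addnK.
rewrite card_set_pairs big_blk big_distrr /=; apply: eq_bigr => i _.
transitivity (\sum_(k < m) \sum_(j < s)
    m * (((i, j) \in blocks_in D) && (i <= j))).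
  apply: eq_bigr => k _; rewrite big_blk; apply: eq_bigr => j _.
  transitivity (\sum_(l < m) (((i, j) \in blocks_in D) && (i <= j))).
    apply: eq_bigr => l _.
    have quoE (i' : 'I_s) (k' : 'I_m) : (i' * m + k') %/ m = i'.
      exact (congr1 (@nat_of_ord s) (blk_quoK i' k')).
    by rewrite inE /= !quoE mem_block_Ferrers // !blk_quoK.
  by rewrite big_const_ord iter_addn_0 mulnC.
by rewrite big_const_ord iter_addn_0 -big_distrr /= mulnAC.
Qed.

(** Move a block of D up and to the right: until the last column is reached,
    only the column changes; afterwards only the row does. *)
Lemma diag_blocks_in_succ (s m : nat) (D : {set 'I_(s * m) * 'I_(s * m)}) e e' :
    0 < m -> is_block_Ferrers D -> e <= e' < s ->
  0 < #|diag_blocks_in D e| -> 0 < #|diag_blocks_in D e'|.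
Proof.
move=> m_gt0 FD /andP[le_e lt_e'] /card_gt0P[[i j]].
rewrite !inE /= => /andP[Bij /eqP Dj].
(* The block (j' - e', j') with j' = maxn j e' is the witness. *)
have lt_j' : maxn j e' < s by rewrite gtn_max ltn_ord.
have lt_i' : maxn j e' - e' < s by rewrite (leq_ltn_trans (leq_subr _ _)).
apply/card_gt0P; exists (Ordinal lt_i', Ordinal lt_j').
rewrite inE /= subnKC ?leq_maxr // eqxx andbT.
apply: (@blocks_in_mono _ _ _ i _ j) => //=; first by rewrite inE.
  by have := ltn_ord i; lia.
exact: leq_maxl.
Qed.

Lemma MSRD_dimE (s m : nat) (D : {set 'I_(s * m) * 'I_(s * m)}) d :
    0 < m ->
  m * \sum_(1 <= i < s.+1) (m * #|block_diag s m i :&: block_set D| + 1 - d)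
    = m * \sum_(e < s) (m * #|diag_blocks_in D e| + 1 - d).
Proof.
move=> m_gt0; congr (_ * _).
rewrite big_add1 big_mkord (reindex_inj rev_ord_inj) /=.
apply: eq_bigr => e _; have lt_e := ltn_ord e.
rewrite card_block_diag //; last by lia.
by rewrite (_ : s - (s - e.+1).+1 = e) //; lia.
Qed.

(** Here the MSRD formula is #|Dup| - (d - 1) N with N = (s - e0) m, where e0
    is the index of the longest nonempty block diagonal; this is the dimension
    guaranteed by [supported_Gabidulin_code] on the top right N x N square. *)
Lemma MFD_small_distance (K : finFieldType) (s m d : nat)
    (D : {set 'I_(s * m) * 'I_(s * m)}) :
    0 < m -> is_block_Ferrers D -> 0 < d <= m.+1 -> MSRD_constructible D d ->
  exists C : {vspace 'M[K]_(s * m)}, is_MFD_code D (nu_min D d) d C.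
Proof.
move=> m_gt0 FD /andP[d_gt0 le_dm] hD.
pose Dup := [set p in D | blk_quo p.1 <= blk_quo p.2].
pose b e := #|diag_blocks_in D e|.
(* If all block diagonals are empty, e0 = s and the square has side N = 0. *)
have [e0 le_e0s [e0P bE0]] : exists2 e0, e0 <= s &
    (forall e, e0 <= e < s -> 0 < b e) /\ (forall e, e < e0 -> b e = 0).
  have [/existsP[e1 b_e1]|] := boolP [exists e : 'I_s, 0 < b e].
    have ex_e : exists e, (e < s) && (0 < b e) by exists e1; rewrite ltn_ord.
    have [e0 /andP[lt_e0 b_e0] min_e0] := ex_minnP ex_e.
    exists e0; first exact: ltnW.
    split=> [e /(diag_blocks_in_succ m_gt0 FD)|e lt_e]; first exact.
    apply/eqP; rewrite -leqn0 leqNgt; apply/negP=> b_e.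
    have := min_e0 e; rewrite b_e (ltn_trans lt_e) // leqNgt lt_e.
    by move/(_ isT).
  rewrite negb_exists => /forallP b0; exists s => //; split=> [e|e lt_e].
    by rewrite ltnNge andbC; case: (s <= e).
  by have := b0 (Ordinal lt_e); rewrite -eqn0Ngt => /eqP.
pose N := (s - e0) * m.
have cardDup : #|Dup| = nu_min D d + d.-1 * N.
  rewrite card_block_Ferrers_upper // hD MSRD_dimE //.
  have -> : d.-1 * N = m * \sum_(e < s) (if e0 <= e then d.-1 else 0).
    rewrite -big_mkcond /= sum_nat_cond_const.
    rewrite /N (mulnC _ m) mulnCA (mulnC d.-1); congr (_ * (_ * _)).
    rewrite -[LHS](card_ord_itv e0 (leqnn s)).
    by apply: eq_card => e; rewrite !inE ltn_ord andbT.
  rewrite -mulnDr -mulnA -big_split big_distrr /=; congr (_ * _).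
  apply: eq_bigr => e _; rewrite -/(b e); case: leqP => [le_e|lt_e]; last first.
    by rewrite bE0 // muln0; lia.
  (* As d - 1 <= m <= m b, the truncated subtraction loses nothing. *)
  have b_e : m <= m * b e by rewrite leq_pmulr // e0P // le_e ltn_ord.
  by lia.
have lt_rho (i : 'I_N) : i < s * m.
  by apply: leq_trans (ltn_ord i) _; rewrite leq_mul2r leq_subr orbT.
have lt_kappa (i : 'I_N) : e0 * m + i < s * m.
  by rewrite -[X in _ < X * _](subnKC le_e0s) mulnDl ltn_add2l.
pose rho i := Ordinal (lt_rho i); pose kappa i := Ordinal (lt_kappa i).
have [||p|C [suppC rkC dimC]] :=
    @supported_Gabidulin_code K _ N d rho kappa Dup _ _ d_gt0.
- by move=> i j [/val_inj].
- by move=> i j [/addnI/val_inj].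
- case: p => x y; rewrite inE /= mem_block_Ferrers // => /andP[Bxy le_xy].
  have le_e : e0 <= blk_quo y - blk_quo x.
    rewrite leqNgt; apply/negP=> /bE0 /eqP; apply/negP; rewrite -lt0n.
    apply/card_gt0P; exists (blk_quo x, blk_quo y).
    by rewrite inE Bxy /= subnK.
  have lt_qy := ltn_ord (blk_quo y).
  have lt_qx : x %/ m < s - e0 by move: le_e le_xy lt_qy => /=; lia.
  have le_qy : e0 <= y %/ m by apply: leq_trans le_e (leq_subr _ _).
  have lt_xN : x < N by rewrite -ltn_divLR.
  have le_y : e0 * m <= y by rewrite -leq_divRL.
  have lt_yN : y - e0 * m < N by rewrite ltn_subLR // -mulnDl subnKC.
  exists (Ordinal lt_xN), (Ordinal lt_yN).
  by congr (_, _); apply: val_inj; rewrite //= subnKC.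
apply: (@MFD_of_large_code K _ D d C) => //.
- exact: FD.1.
- move=> A /suppC suppA x y /negPf D'xy; apply: suppA.
  by rewrite inE D'xy.
by rewrite -(leq_add2r (d.-1 * N)) -cardDup.
Qed.

(** A block diagonal at distance e > 0 from the main one has at most s - 1
    blocks, and m (s - 1) < d because m > 1, so it contributes nothing. *)
Lemma MFD_large_distance (K : finFieldType) (s m d : nat)
    (D : {set 'I_(s * m) * 'I_(s * m)}) :
    1 < m -> 1 < s -> is_block_Ferrers D -> s * m - 1 <= d <= s * m ->
    MSRD_constructible D d ->
  exists C : {vspace 'M[K]_(s * m)}, is_MFD_code D (nu_min D d) d C.
Proof.
move=> m_gt1 s_gt1 FD /andP[ge_d le_d] hD; have m_gt0 := ltnW m_gt1.
have sm_ge4 : 4 <= s * m by rewrite (@leq_mul 2 2).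
have d_gt0 : 0 < d by lia.
have ge_sm : m + m * s.-1 - 1 <= d.
  by rewrite -mulnS prednK 1?mulnC // ltnW.
have nuE : nu_min D d = m * (m * #|diag_blocks_in D 0| + 1 - d).
  rewrite hD MSRD_dimE //.
  rewrite -(big_mkord xpredT (fun e => m * #|diag_blocks_in D e| + 1 - d)).
  rewrite big_ltn ?(ltnW s_gt1) // big_nat big1 ?addn0 // => e /andP[e_gt0 _].
  have le_b : #|diag_blocks_in D e| <= s.-1.
    by apply: leq_trans (card_diag_blocks_le D e) _; lia.
  by have := leq_mul (leqnn m) le_b; move: ge_sm; lia.
have [ge_b|lt_b] := leqP s #|diag_blocks_in D 0|; last first.
  apply: (@MFD_of_large_code K _ D d 0%VS) => //; first exact: FD.1.
  - by move=> A; rewrite memv0 => /eqP-> x y _; rewrite mxE.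
  - by move=> A; rewrite memv0 => ->.
  rewrite nuE dimv0 leqn0 muln_eq0 subn_eq0; apply/orP; right.
  have : m * #|diag_blocks_in D 0| <= m * s.-1.
    by rewrite leq_mul2l -ltnS prednK ?lt_b ?orbT // ltnW.
  by move: ge_sm; lia.
have eq_b : #|diag_blocks_in D 0| = s.
  by apply/anti_leq; rewrite ge_b -[X in _ <= X]subn0 card_diag_blocks_le.
have diagB i : (i, i) \in blocks_in D.
  suffices /setP/(_ (i, i)) : diag_blocks_in D 0 = [set (i, i) | i : 'I_s].
    by rewrite inE imset_f // => /andP[].
  apply/eqP; rewrite eqEcard; apply/andP; split.
    apply/subsetP=> -[i' j]; rewrite inE /= => /andP[_ /eqP Dj].
    by apply/imsetP; exists i'; rewrite // (_ : j = i') //; apply: val_inj.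
  by rewrite eq_b -[leqRHS]card_ord leq_imset_card.
have [||x y le_xy|C [suppC rkC dimC]] :=
    @staircase_code K s m ((s * m).+1 - d) D m_gt0.
- lia.
- lia.
- rewrite mem_block_Ferrers //.
  exact: (blocks_in_mono m_gt0 FD (diagB (blk_quo x))).
apply: (@MFD_of_large_code K _ D d C) => //; first exact: FD.1.
  by move=> A CA nzA; have := rkC A CA nzA; lia.
by rewrite nuE eq_b dimC mulnC (mulnC m s) addn1.
Qed.

Theorem corollary5p10 (m s : nat) (hm : 2 <= m) (hs : 2 <= s)
    (D : {set 'I_(s * m) * 'I_(s * m)}) (hD : is_block_Ferrers D)
    (d : nat) (hd : 1 <= d <= m.+1 \/ d = s * m - 1 \/ d = s * m)
    (hDd : MSRD_constructible D d) (K : finFieldType) :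
  exists C : {vspace 'M[K]_(s * m)}, is_MFD_code D (nu_min D d) d C.
Proof.
case: hd => [d_small|d_large].
  by apply: MFD_small_distance => //; apply: ltnW.
apply: MFD_large_distance => //.
by case: d_large => ->; lia.
Qed.
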